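(* Let $\mathcal F$ be a weighted cellular cosheaf on a finite regular cell complex $X$, and let $a,b\in\ker\partial_k\subseteq C_k(X;\mathcal F)$ be homologous $k$-cycles (that is, $b-a\in\operatorname{im}\partial_{k+1}$). Then the effective resistance $$R_{\mathrm{eff}}(a,b)=\min\{\|c\|^2: c\in C_{k+1}(X;\mathcal F),\ \partial_{k+1}c=b-a\}$$ is given by $$R_{\mathrm{eff}}(a,b)=\langle b-a,(L^k_{\mathcal F})^\dagger(b-a)\rangle,$$ where $L^k_{\mathcal F}=\partial_{k+1}\partial_{k+1}^*$ is the up-Laplacian.
   Context: A regular cell complex is identified with its face poset; $\sigma\trianglelefteq\tau$ means that the cell $\sigma$ is contained in the closure of $\tau$. A weighted cellular cosheaf $\mathcal F$ on $X$ assigns to each cell $\sigma$ a finite-dimensional inner product space $\mathcal F(\sigma)$ over $\Bbbk=\mathbb R$ or $\mathbb C$ and to each $\sigma\trianglelefteq\tau$ a linear map $\mathcal F_{\sigma\trianglelefteq\tau}:\mathcal F(\tau)\to\mathcal F(\sigma)$ with $\mathcal F_{\sigma\trianglelefteq\sigma}=\mathrm{id}$ and $\mathcal F_{\rho\trianglelefteq\tau}=\mathcal F_{\rho\trianglelefteq\sigma}\circ\mathcal F_{\sigma\trianglelefteq\tau}$ for $\rho\trianglelefteq\sigma\trianglelefteq\tau$. The chain spaces are the orthogonal direct sums $C_k(X;\mathcal F)=\bigoplus_{\dim\sigma=k}\mathcal F(\sigma)$. Fix a signed incidence relation $[\sigma:\tau]\in\{0,\pm1\}$ coming from orientations of cells: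 it is nonzero exactly when $\sigma$ is a codimension-one face of $\tau$, and $\sum_\gamma[\sigma:\gamma][\gamma:\tau]=0$ for all $\sigma\trianglelefteq\tau$. The boundary map is $(\partial_{k+1}c)_\sigma=\sum_{\dim\tau=k+1}[\sigma:\tau]\mathcal F_{\sigma\trianglelefteq\tau}(c_\tau)$; it satisfies $\partial_k\partial_{k+1}=0$. $A^\dagger$ denotes the Moore–Penrose pseudoinverse of $A$. *)

(* Defs.v *)
From HB Require Import structures.
From mathcomp Require Import all_boot all_order all_algebra.
From mathcomp Require Import complex.
From mathcomp Require Import all_classical all_reals all_analysis.

Set Implicit Arguments.
Unset Strict Implicit.
Unset Printing Implicit Defensive.

Import Order.TTheory GRing.Theory Num.Theory.
Import numFieldNormedType.Exports.
Local Open Scope classical_set_scope.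
Local Open Scope ring_scope.

Variant scalar_kind := RealScalars | ComplexScalars.

Definition scalars (R : realType) (s : scalar_kind) : numFieldType :=
  match s with RealScalars => R | ComplexScalars => R[i] end.

Definition scalar_conj (R : realType) (s : scalar_kind) :
    {rmorphism scalars R s -> scalars R s} :=
  match s with RealScalars => idfun | ComplexScalars => @Num.conj R[i] end.

(* The library equips [{ffun I -> vT}] with a vector space structure only for a
   constant [vT]; here the summands vary with the index. *)
Section DirectSum.
Variables (K : nzRingType) (I : finType) (V : I -> vectType K).

Definition dsum : Type := {dffun forall i : I, V i}.

HB.instance Definition _ := Choice.on dsum.

Implicit Types f g h : dsum.

Definition dsum_zero : dsum := [ffun i => 0].
Definition dsum_add f g : dsum := [ffun i => f i + g i].
Definition dsum_opp f : dsum := [ffun i => - f i].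
Definition dsum_scale (c : K) f : dsum := [ffun i => c *: f i].

Fact dsum_addA : associative dsum_add.
Proof. by move=> f g h; apply/ffunP => i; rewrite !ffunE addrA. Qed.
Fact dsum_addC : commutative dsum_add.
Proof. by move=> f g; apply/ffunP => i; rewrite !ffunE addrC. Qed.
Fact dsum_add0 : left_id dsum_zero dsum_add.
Proof. by move=> f; apply/ffunP => i; rewrite !ffunE add0r. Qed.
Fact dsum_addN : left_inverse dsum_zero dsum_opp dsum_add.
Proof. by move=> f; apply/ffunP => i; rewrite !ffunE addNr. Qed.

HB.instance Definition _ :=
  GRing.isZmodule.Build dsum dsum_addA dsum_addC dsum_add0 dsum_addN.

Fact dsum_scaleA a b f : dsum_scale a (dsum_scale b f) = dsum_scale (a * b) f.
Proof. by apply/ffunP => i; rewrite !ffunE scalerA. Qed.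
Fact dsum_scale1 : left_id 1 dsum_scale.
Proof. by move=> f; apply/ffunP => i; rewrite !ffunE scale1r. Qed.
Fact dsum_scaleDr : right_distributive dsum_scale +%R.
Proof. by move=> a f g; apply/ffunP => i; rewrite !ffunE scalerDr. Qed.
Fact dsum_scaleDl f : {morph dsum_scale^~ f : a b / a + b}.
Proof. by move=> a b; apply/ffunP => i; rewrite !ffunE scalerDl. Qed.

HB.instance Definition _ := GRing.Zmodule_isLmodule.Build K dsum
  dsum_scaleA dsum_scale1 dsum_scaleDr dsum_scaleDl.

Lemma dsum0E i : (0 : dsum) i = 0. Proof. exact: ffunE. Qed.
Lemma dsumDE f g i : (f + g) i = f i + g i. Proof. exact: ffunE. Qed.
Lemma dsumNE f i : (- f) i = - f i. Proof. exact: ffunE. Qed.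
Lemma dsumZE c f i : (c *: f) i = c *: f i. Proof. exact: ffunE. Qed.

Import VectorInternalTheory.

Let coord : finType := {i : I & 'I_(dim (V i))}.

Fact dsum_vect_axiom : Vector.axiom #|coord| dsum.
Proof.
pose phi (f : dsum) : 'rV[K]_#|coord| :=
  \row_t v2r (f (tag (enum_val t))) 0 (tagged (enum_val t)).
pose psi (r : 'rV[K]_#|coord|) : dsum :=
  [ffun i => r2v (\row_j r 0 (enum_rank (Tagged _ j : coord)))].
exists phi.
  by move=> c f g; apply/rowP => t; rewrite !mxE dsumDE dsumZE linearP !mxE.
exists psi => [f|r].
  apply/ffunP => i; rewrite ffunE -[RHS]v2rK; congr r2v.
  by apply/rowP => j; rewrite !mxE enum_rankK.
apply/rowP => t; rewrite !mxE ffunE r2vK mxE; congr (r _ _).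
by rewrite -[RHS]enum_valK; congr enum_rank; case: (enum_val t).
Qed.

HB.instance Definition _ := Lmodule_hasFinDim.Build K dsum dsum_vect_axiom.

End DirectSum.

Section DirectSumDot.
Variables (K : numFieldType) (theta : {rmorphism K -> K}).
Variables (I : finType) (V : I -> vectType K).
Variable (d : forall i, {dot V i for theta}).

Definition dsum_dot (u v : dsum V) : K := \sum_i d i (u i) (v i).

Fact dsum_dot_bilinear : bilinear_for
  (GRing.Scale.Law.clone _ _ *%R _) (GRing.Scale.Law.clone _ _ (theta \; *%R) _)
  dsum_dot.
Proof.
split=> [u a x y|u a x y] /=; rewrite /dsum_dot mulr_sumr -big_split /=.
  by apply: eq_bigr => i _; rewrite dsumDE dsumZE linearPl.
by apply: eq_bigr => i _; rewrite dsumDE dsumZE linearPr.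
Qed.

HB.instance Definition _ := bilinear_isBilinear.Build K (dsum V) (dsum V) K
  *%R (theta \; *%R) dsum_dot dsum_dot_bilinear.

Fact dsum_dot_hermitian u v :
  dsum_dot u v = (-1) ^+ false * theta (dsum_dot v u).
Proof.
rewrite /dsum_dot expr0 mul1r rmorph_sum; apply: eq_bigr => i _.
by rewrite hermC expr0 mul1r.
Qed.

HB.instance Definition _ := isHermitianSesquilinear.Build K (dsum V) false theta
  dsum_dot dsum_dot_hermitian.

Fact dsum_dot_gt0 u : u != 0 -> 0 < dsum_dot u u.
Proof.
move=> u0.
have d_ge0 i x : 0 <= d i x x.
  by have [->|/neq0_dnorm_gt0/ltW//] := eqVneq x 0; rewrite linear0l.
have [i ui] : exists i, u i != 0.
  apply/existsP; apply: contraNT u0; rewrite negb_exists => /forallP u0.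
  by apply/eqP/ffunP => i; rewrite dsum0E; apply/eqP; rewrite -[_ == _]negbK.
by rewrite /dsum_dot (bigD1 i)//= ltr_wpDr ?sumr_ge0 ?neq0_dnorm_gt0.
Qed.

HB.instance Definition _ := isDotProduct.Build K (dsum V) dsum_dot dsum_dot_gt0.

End DirectSumDot.

Section InnerProductSpaces.
Variables (K : numFieldType) (theta : {rmorphism K -> K}).
Variables (U V : vectType K).
Variables (dU : {dot U for theta}) (dV : {dot V for theta}).

Definition is_adjoint (A : 'Hom(U, V)) (B : 'Hom(V, U)) :=
  forall u v, dV (A u) v = dU u (B v).

(* In finite dimension exactly one [B] satisfies [is_adjoint A B], so the default
   value 0 of [xget] is never returned. *)
Definition adjoint (A : 'Hom(U, V)) : 'Hom(V, U) := xget 0 [set B | is_adjoint A B].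

End InnerProductSpaces.

Section MoorePenrose.
Variables (K : numFieldType) (theta : {rmorphism K -> K}).
Variables (U V : vectType K).
Variables (dU : {dot U for theta}) (dV : {dot V for theta}).

(* The four Penrose conditions; they determine [B]. *)
Definition is_pseudoinverse (A : 'Hom(U, V)) (B : 'Hom(V, U)) :=
  [/\ (A \o B \o A)%VF = A, (B \o A \o B)%VF = B,
      is_adjoint dV dV (A \o B)%VF (A \o B)%VF &
      is_adjoint dU dU (B \o A)%VF (B \o A)%VF].

Definition pseudoinverse (A : 'Hom(U, V)) : 'Hom(V, U) :=
  xget 0 [set B | is_pseudoinverse A B].

End MoorePenrose.

(* Over R[i] the order is the partial one ([x <= y] iff [y - x] is a nonnegative
   real); below it is only applied to squared norms, which are real. *)
Definition minima (K : numFieldType) (S : set K) : set K := S `&` lbound S.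

Section Topology.
Variable R : realType.

Definition euclidean_closed_ball n : set 'rV[R]_n :=
  [set x | \sum_i x 0 i ^+ 2 <= 1].
Definition euclidean_open_ball n : set 'rV[R]_n :=
  [set x | \sum_i x 0 i ^+ 2 < 1].

Definition homeomorphism_on (S T : topologicalType) (A : set S) (B : set T)
    (f : S -> T) :=
  [/\ set_bij A B f, {within A, continuous f} &
      exists g : T -> S, {in A, cancel f g} /\ {within B, continuous g}].

(* Finite regular CW complexes: a Hausdorff space with a finite partition into open
   cells, each with a characteristic map that is a homeomorphism from the closed
   ball onto the closure of the cell, the boundary of a cell lying in cells of
   smaller dimension. *)
Record finite_regular_complex := FiniteRegularComplex {
  underlying_space : topologicalType;
  cell :> finType;
  cell_set : cell -> set underlying_space;
  cell_dim : cell -> nat;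
  space_hausdorff : hausdorff_space underlying_space;
  cell_set_cover : \bigcup_s cell_set s = setT;
  cell_set_trivIset : trivIset setT cell_set;
  characteristic_map : forall s, exists f : 'rV[R]_(cell_dim s) -> underlying_space,
      [/\ homeomorphism_on (@euclidean_closed_ball (cell_dim s))
            (closure (cell_set s)) f,
          f @` @euclidean_open_ball (cell_dim s) = cell_set s &
          forall x, closure (cell_set s) x -> ~ cell_set s x ->
            exists2 t, (cell_dim t < cell_dim s)%N & cell_set t x]
}.

End Topology.

Section Complexes.
Variables (R : realType) (X : finite_regular_complex R).

Definition face (s t : X) : Prop := cell_set s `<=` closure (cell_set t).

Definition facet (s t : X) : Prop := face s t /\ cell_dim t = (cell_dim s).+1.

(* These are the only properties of [_ : _] used; every incidence relation coming
   from orientations of the cells has them. *)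
Record signed_incidence := SignedIncidence {
  incidence :> X -> X -> int;
  incidence_sign : forall s t, incidence s t \in [:: 0; 1; -1];
  incidence_neq0 : forall s t, incidence s t <> 0 <-> facet s t;
  incidence_sum : forall s t, face s t ->
    \sum_(g : X) incidence s g * incidence g t = 0
}.

(* [corestriction s t] is the structure map of the pair s <| t. It is a total function
   of (s, t), but off the face relation its values are unconstrained and do not
   contribute to the boundary map, where they are multiplied by [incidence s t = 0]. *)
Record weighted_cosheaf (k : scalar_kind) := WeightedCosheaf {
  stalk :> X -> vectType (scalars R k);
  stalk_dot : forall s, {dot stalk s for scalar_conj R k};
  corestriction : forall s t, 'Hom(stalk t, stalk s);
  corestriction_id : forall s, corestriction s s = \1%VF;
  corestriction_comp : forall r s t, face r s -> face s t ->
    corestriction r t = (corestriction r s \o corestriction s t)%VF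
}.

Definition cells (n : nat) : finType := {s : X | cell_dim s == n}.

End Complexes.

Section Chains.
Variables (R : realType) (X : finite_regular_complex R) (k : scalar_kind).
Variables (inc : signed_incidence X) (F : weighted_cosheaf X k).

Definition chain (n : nat) : vectType (scalars R k) :=
  dsum (fun s : cells X n => F (val s)).

Definition chain_dot (n : nat) : {dot chain n for scalar_conj R k} :=
  dsum_dot (fun s : cells X n => stalk_dot F (val s)).

Definition boundary_fun (n : nat) (c : chain n.+1) : chain n :=
  [ffun s : cells X n => \sum_(t : cells X n.+1)
     (inc (val s) (val t))%:~R *: corestriction F (val s) (val t) ((c : dsum _) t)].

Fact boundary_fun_linear n : linear (@boundary_fun n).
Proof.
move=> a x y; apply/ffunP => s; rewrite dsumDE dsumZE !ffunE scaler_sumr.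
rewrite -big_split /=; apply: eq_bigr => t _.
by rewrite dsumDE dsumZE linearP scalerDr !scalerA mulrC.
Qed.

HB.instance Definition _ n := GRing.isLinear.Build _ _ _ _
  (@boundary_fun n) (@boundary_fun_linear n).

(* [boundary n] is \partial_{n+1} : C_{n+1} -> C_n. *)
Definition boundary (n : nat) : 'Hom(chain n.+1, chain n) :=
  linfun (@boundary_fun n).

Lemma boundaryE n (c : chain n.+1) (s : cells X n) :
  (boundary n c : dsum _) s = \sum_(t : cells X n.+1)
     (inc (val s) (val t))%:~R *: corestriction F (val s) (val t) ((c : dsum _) t).
Proof. by rewrite lfunE ffunE. Qed.

(* ker \partial_n, where \partial_0 : C_0 -> 0. *)
Definition cycles (n : nat) : {vspace chain n} :=
  match n with 0 => fullv | m.+1 => lker (boundary m) end.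

Definition up_laplacian (n : nat) : 'End(chain n) :=
  (boundary n \o adjoint (chain_dot n.+1) (chain_dot n) (boundary n))%VF.

(* The squared norms ||c||^2 of the chains c with \partial_{n+1} c = b - a. *)
Definition filling_energies (n : nat) (a b : chain n) : set (scalars R k) :=
  [set chain_dot n.+1 c c | c in [set c | boundary n c = b - a]].

Definition effective_resistance (n : nat) (a b : chain n) : scalars R k :=
  xget 0 (minima (filling_energies a b)).

End Chains.

(* Main.v *)
From HB Require Import structures.
Require Import Defs.
From mathcomp Require Import all_boot all_order all_algebra.
From mathcomp Require Import complex.
From mathcomp Require Import all_classical all_reals all_analysis.

Set Implicit Arguments.
Unset Strict Implicit.
Unset Printing Implicit Defensive.

Import Order.TTheory GRing.Theory Num.Theory.
Local Open Scope classical_set_scope.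
Local Open Scope ring_scope.

(** With B = boundary, L = B B^* and y = b - a, the chain c0 = B^* L^+ y is
    the least squares filling of y. The projection L L^+ fixes im B, because
    E = L L^+ - 1 is self-adjoint, E L = 0, and hence
    |B^* E v|^2 = <E L E v, v> = 0; so B^* E = 0, its adjoint E B vanishes and
    B c0 = L L^+ y = y. Moreover c0 lies in im B^*, the orthogonal complement
    of ker B, so by Pythagoras it is the shortest solution of B c = y, and
    |c0|^2 = <B c0, L^+ y> = <y, L^+ y>. *)

Section DotProducts.
Variables (K : numFieldType) (theta : {rmorphism K -> K}).

Lemma dot_conjC (U : vectType K) (d : {dot U for theta}) u v :
  d u v = theta (d v u).
Proof. by rewrite hermC expr0 mul1r. Qed.

Lemma dot_ge0 (U : vectType K) (d : {dot U for theta}) u : 0 <= d u u.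
Proof. by have [->|/neq0_dnorm_gt0/ltW//] := eqVneq u 0; rewrite linear0l. Qed.

Lemma dot_self_eq0 (U : vectType K) (d : {dot U for theta}) u :
  d u u = 0 -> u = 0.
Proof.
move=> du0; apply/eqP; apply/negPn/negP => /neq0_dnorm_gt0 -/(_ theta d).
by rewrite du0 ltxx.
Qed.

Lemma dot_eq0C (U : vectType K) (d : {dot U for theta}) u v :
  d u v = 0 -> d v u = 0.
Proof. by move=> duv; rewrite dot_conjC duv rmorph0. Qed.

(* The coordinates [d v (e i)], unlike [d (e i) v], depend linearly on [v]. *)
Definition gram (U : vectType K) (d : {dot U for theta}) n (e : 'I_n -> U) v :
  'rV[K]_n := \row_i d v (e i).

Fact gram_linear (U : vectType K) (d : {dot U for theta}) n (e : 'I_n -> U) :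
  linear (gram d e).
Proof. by move=> a u v; apply/rowP => i; rewrite !mxE linearPl. Qed.

HB.instance Definition _ (U : vectType K) (d : {dot U for theta}) n
    (e : 'I_n -> U) :=
  GRing.isLinear.Build K U 'rV[K]_n _ (gram d e) (gram_linear d e).

Section Adjoint.
Variables (U V : vectType K) (dU : {dot U for theta}) (dV : {dot V for theta}).

Lemma is_adjoint_sym (A : 'Hom(U, V)) (B : 'Hom(V, U)) :
  is_adjoint dU dV A B -> is_adjoint dV dU B A.
Proof. by move=> AB v u; rewrite dot_conjC -AB -dot_conjC. Qed.

(** Riesz representation in coordinates: [T] pairs a vector with each basis vector [e_i] and [S]
    pairs [v] with each [A e_i], so [B] must solve [T (B v) = S v]. Definiteness makes [T]
    injective, hence bijective by dimension. *)
Lemma adjoint_exists (A : 'Hom(U, V)) : exists B, is_adjoint dU dV A B.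
Proof.
pose T := linfun (gram dU (fun i : 'I_(\dim {:U}) => (vbasis {:U})`_i)).
pose S := linfun (gram dV (fun i : 'I_(\dim {:U}) => A (vbasis {:U})`_i)).
have dot_basis (u w : U) : T u = T w -> u = w.
  rewrite !lfunE => /rowP Tuw; apply/eqP; rewrite -subr_eq0; apply/eqP.
  apply: (@dot_self_eq0 _ dU).
  rewrite [X in dU _ X](coord_vbasis (memvf _)) linear_sumr big1// => i _.
  rewrite linearZr_LR /= [X in _ * X](_ : _ = 0) ?mulr0//.
  apply/eqP; rewrite linearBl subr_eq0; apply/eqP.
  by have := Tuw i; rewrite !mxE.
have /lker0P kerT : injective T by [].
have limgT : limg T = fullv.
  apply/eqP; rewrite eqEdim subvf limg_dim_eq ?(eqP kerT) ?capv0//.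
  by rewrite dimvf /dim/= mul1n.
exists (T^-1 \o S)%VF => u v.
have TB : T ((T^-1 \o S)%VF v) = S v.
  by rewrite comp_lfunE limg_lfunVK// limgT memvf.
(* Conjugation moves [u] to the second argument; expanded there in the basis, it leaves the
   coordinates of [S v] and [T (B v)] to compare. *)
rewrite [LHS]dot_conjC [RHS]dot_conjC; congr (theta _).
rewrite (coord_vbasis (memvf u)) linear_sum !linear_sumr.
apply: eq_bigr => i _; rewrite linearZ !linearZr_LR /=; congr (_ * _).
by move/rowP/(_ i): TB; rewrite !lfunE !mxE.
Qed.

Lemma adjointP (A : 'Hom(U, V)) : is_adjoint dU dV A (adjoint dU dV A).
Proof. exact: (xgetPex 0 (adjoint_exists A)). Qed.

End Adjoint.

Section SelfAdjoint.
Variables (V : vectType K) (dV : {dot V for theta}) (L : 'End(V)).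
Hypothesis Lsa : is_adjoint dV dV L L.

Lemma lker_orthogonal_limg u v : u \in lker L -> v \in limg L -> dV u v = 0.
Proof.
rewrite memv_ker => /eqP Lu0 /memv_imgP[w _ ->].
by rewrite -Lsa Lu0 linear0l.
Qed.

Lemma limg_cap_lker : (limg L :&: lker L = 0)%VS.
Proof.
apply/eqP; rewrite -subv0; apply/subvP => u.
rewrite memv_cap => /andP[uim uker].
by rewrite memv0; apply/eqP/(@dot_self_eq0 _ dV)/lker_orthogonal_limg.
Qed.

Lemma limg_add_lker : (limg L + lker L = fullv)%VS.
Proof.
apply/eqP; rewrite eqEdim subvf/= dimv_disjoint_sum ?limg_cap_lker//.
by rewrite addnC -[X in (\dim X + _)%N]capfv limg_ker_dim.
Qed.

Let Q := daddv_pi (limg L) (lker L).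

(** The space is the orthogonal sum of [limg L] and [lker L], and [L] is invertible on its image.
    Inverting it there and extending by zero on the kernel makes [L \o P] and [P \o L] both equal to
    the orthogonal projection [Q], which yields all four Penrose conditions. *)
Lemma pseudoinverse_exists : exists P, is_pseudoinverse dV dV L P.
Proof.
have Qker v : v - Q v \in lker L.
  have := daddv_pi_add (w := v) limg_cap_lker.
  rewrite limg_add_lker memvf => /(_ isT) {1}<-.
  by rewrite addrC addKr memv_pi.
have LQ v : L (Q v) = L v.
  by apply/esym/eqP; rewrite -subr_eq0 -linearB -memv_ker.
have Qim v : v \in limg L -> Q v = v by exact: daddv_pi_id limg_cap_lker.
have Q0 v : v \in lker L -> Q v = 0.
  move=> vker; apply/eqP; rewrite -memv0 -limg_cap_lker memv_cap memv_pi.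
  by rewrite memv_ker LQ -memv_ker.
(* On [limg L] the map [L^-1] only picks some preimage; the outer [Q] removes its kernel
   component. *)
pose P := (Q \o L^-1 \o Q)%VF.
have LPE : (L \o P = Q)%VF.
  by apply/lfunP => v; rewrite !comp_lfunE LQ limg_lfunVK ?memv_pi.
have PLE : (P \o L = Q)%VF.
  apply/lfunP => v; rewrite !comp_lfunE [Q (L v)]Qim ?memv_img ?memvf//.
  have /Q0/eqP : (L^-1)%VF (L v) - v \in lker L.
    rewrite memv_ker linearB subr_eq0; apply/eqP/limg_lfunVK.
    by rewrite memv_img ?memvf.
  by rewrite linearB subr_eq0 => /eqP.
have Qsa : is_adjoint dV dV Q Q.
  (* Both sides reduce to this value, since [u - Q u] and [v - Q v] lie in the kernel, orthogonal to
     the image. *)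
  move=> u v; transitivity (dV (Q u) (Q v)).
    apply/eqP; rewrite -subr_eq0 -linearBr; apply/eqP/dot_eq0C.
    by rewrite lker_orthogonal_limg ?memv_pi.
  apply/esym/eqP; rewrite -subr_eq0 -linearBl; apply/eqP.
  by apply: lker_orthogonal_limg; rewrite ?memv_pi.
exists P; split; rewrite ?LPE ?PLE//.
  by apply/lfunP => v; rewrite comp_lfunE Qim ?memv_img ?memvf.
by apply/lfunP => v; rewrite !comp_lfunE [Q (Q _)]Qim ?memv_pi.
Qed.

Lemma pseudoinverseP : is_pseudoinverse dV dV L (pseudoinverse dV dV L).
Proof. exact: (xgetPex 0 pseudoinverse_exists). Qed.

End SelfAdjoint.

Section LeastNorm.
Variables (U V : vectType K) (dU : {dot U for theta}) (dV : {dot V for theta}).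
Variable B : 'Hom(U, V).
Let A := adjoint dU dV B.
Let L := (B \o A)%VF.
Let P := pseudoinverse dV dV L.

Lemma comp_adjoint_selfadjoint : is_adjoint dV dV L L.
Proof.
have BA := adjointP dU dV B.
by move=> u v; rewrite !comp_lfunE BA -(is_adjoint_sym BA).
Qed.

Lemma comp_adjoint_pseudoinverse_id y : y \in limg B -> L (P y) = y.
Proof.
have [LPL _ LPsa _] := pseudoinverseP comp_adjoint_selfadjoint.
pose E := ((L \o P) - \1)%VF.
have EE v : E v = L (P v) - v.
  by rewrite add_lfunE opp_lfunE id_lfunE comp_lfunE.
have Esa : is_adjoint dV dV E E.
  move=> u v; rewrite !EE linearBl linearBr.
  by congr (_ - _); have := LPsa u v; rewrite !comp_lfunE.
have EL v : E (B (A v)) = 0.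
  rewrite EE; have /lfunP/(_ v) := LPL; rewrite !comp_lfunE => ->.
  exact: subrr.
have AE v : A (E v) = 0.
  apply: (@dot_self_eq0 _ dU); rewrite -(adjointP dU dV B) -Esa.
  by rewrite EL linear0l.
case/memv_imgP => w _ ->; apply/eqP; rewrite -subr_eq0; apply/eqP.
have -> : L (P (B w)) - B w = E (B w) by rewrite EE.
(* In the squared norm of [E (B w)], moving [E] and then [B] to the second argument produces
   [A (E _)], which vanishes. *)
apply: (@dot_self_eq0 _ dV).
by rewrite Esa (adjointP dU dV B) AE linear0r.
Qed.

Lemma least_norm_solution y : y \in limg B ->
  exists2 c0, B c0 = y /\ dU c0 c0 = dV y (P y) &
    forall c, B c = y -> dU c0 c0 <= dU c c.
Proof.
move=> yB; have Bc0 : B (A (P y)) = y.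
  by rewrite -comp_lfunE comp_adjoint_pseudoinverse_id.
exists (A (P y)).
  by split=> //; rewrite -[in LHS](adjointP dU dV B) Bc0.
(* Pythagoras for [c = c0 + (c - c0)] with [c0 = A (P y)]: the difference lies in the kernel of [B],
   orthogonal to the image of [A]. *)
move=> c Bc; rewrite -[c](subrK (A (P y))) addrC hnormDd.
  by rewrite lerDl dot_ge0.
apply: dot_eq0C; rewrite -(adjointP dU dV B) linearB /= Bc Bc0 subrr.
exact: linear0l.
Qed.

End LeastNorm.

End DotProducts.

Theorem proposition6p2 (R : realType) (K : scalar_kind)
    (X : finite_regular_complex R) (inc : signed_incidence X)
    (F : weighted_cosheaf X K) (k : nat) (a b : chain F k)
    (ha : a \in cycles inc F k) (hb : b \in cycles inc F k)
    (hab : b - a \in limg (boundary inc F k)) :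
  minima (filling_energies inc a b) (effective_resistance inc a b) /\
  effective_resistance inc a b =
    chain_dot F k (b - a)
      (pseudoinverse (chain_dot F k) (chain_dot F k) (up_laplacian inc F k)
        (b - a)).
Proof.
have [c0 [Bc0 c0E] c0_min] :=
  least_norm_solution (chain_dot F k.+1) (chain_dot F k) hab.
have c0_minima :
    minima (filling_energies inc a b) (chain_dot F k.+1 c0 c0).
  by split=> [|_ [c Bc <-]]; [exists c0 | exact: c0_min].
(* A minimum exists, so [xget] returns one instead of its default 0; two minima bound each other, so
   antisymmetry identifies it with the energy of [c0]. *)
have := xgetI 0 c0_minima; rewrite -/(effective_resistance inc a b) => Rmin.
split=> //; rewrite /up_laplacian -c0E.
case: Rmin c0_minima => Rin Rle [c0in c0le].
by apply/eqP; rewrite eq_le Rle// c0le.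
Qed.
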